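(* Consider heteroskedastic Gaussian bandits with arms $\{1,\dots,p\}$, true means $\beta_0=(\beta_{0,1},\dots,\beta_{0,p})$ and known variances $\sigma_1^2,\dots,\sigma_p^2>0$. For each $n$, an independent trajectory $H^n_{m_n}=((a^n_1,y^n_1),\dots,(a^n_{m_n},y^n_{m_n}))$ is generated by: $a^n_j\sim\Lambda^n(\cdot\mid H^n_{j-1})$ (a distribution on $\{1,\dots,p\}$ depending on the past), then $y^n_j\sim\mathcal{N}(\beta_{0,a^n_j},\sigma^2_{a^n_j})$ conditionally on the past and $a^n_j$. Let $N_{i,n}=\sum_{j=1}^{m_n}\mathbf{1}[a^n_j=i]$ and let $\hat\beta_n$ be the vector of per-arm sample means $\hat\beta_{n,i}=N_{i,n}^{-1}\sum_{j}\mathbf{1}[a^n_j=i]y^n_j$. Assume: (i) $\min_iN_{i,n}\xrightarrow{p}\infty$; (ii) the prior $\pi$ is a continuous and bounded density on $\mathbb{R}^p$ with $\pi(\beta_0)>0$. Then $$\big\|\pi(\cdot\mid H^n_{m_n})-\mathcal{N}\big(\hat\beta_n,\mathrm{diag}(\sigma_i^2N_{i,n}^{-1})\big)\big\|_{\mathrm{TV}}\xrightarrow{p}0.$$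
   Context: The sampling rules $\Lambda^n$ may depend on $n$, while $\beta_0$, the $\sigma_i^2$ and $\pi$ do not. The posterior is $\pi(\beta\mid H^n_{m_n})\propto\pi(\beta)\prod_{j=1}^{m_n}\exp\big(-(y^n_j-\beta_{a^n_j})^2/(2\sigma^2_{a^n_j})\big)$. $\|\cdot\|_{\mathrm{TV}}$ is total variation distance. *)

(* Defs.v *)
From HB Require Import structures.
From mathcomp Require Import all_boot all_order all_algebra.
From mathcomp Require Import all_classical all_reals all_analysis.
Set Implicit Arguments.
Unset Strict Implicit.
Unset Printing Implicit Defensive.
Import Order.TTheory GRing.Theory Num.Theory.
Import numFieldNormedType.Exports.
Local Open Scope classical_set_scope.
Local Open Scope ring_scope.

Section Bandit.
Variables (R : realType) (p : nat).

(* A history (trajectory) is a list of (arm, reward) pairs, oldest first. *)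
Definition history := seq ('I_p * R).

Definition npulls (h : history) (i : 'I_p) : nat :=
  count (fun x => x.1 == i) h.

Definition sample_mean (h : history) (i : 'I_p) : R :=
  (\sum_(x <- h | x.1 == i) x.2) / (npulls h i)%:R.

(* Iterated Lebesgue integral over R^p (coordinates p-1, ..., 0),
   of a nonnegative extended-real function on row vectors. *)
Fixpoint int_coords (F : 'rV[R]_p -> \bar R) (k : nat) (v : 'rV[R]_p)
    : \bar R :=
  match k with
  | 0 => F v
  | k'.+1 => \int[lebesgue_measure]_x
               int_coords F k' (\row_j (if nat_of_ord j == k' then (x : R) else v ord0 j))
  end.

Definition int_Rp (F : 'rV[R]_p -> \bar R) : \bar R := int_coords F p 0.

Definition likelihood (sigma : 'I_p -> R) (h : history) (b : 'rV[R]_p) : R :=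
  \prod_(x <- h) expR (- (x.2 - b ord0 x.1) ^+ 2 / (sigma x.1 ^+ 2 *+ 2)).

Definition posterior (prior : 'rV[R]_p -> R) (sigma : 'I_p -> R)
    (h : history) (b : 'rV[R]_p) : R :=
  prior b * likelihood sigma h b /
  fine (int_Rp (fun c => (prior c * likelihood sigma h c)%:E)).

Definition gauss_approx (sigma : 'I_p -> R) (h : history) (b : 'rV[R]_p) : R :=
  \prod_(i < p) normal_pdf (sample_mean h i)
                           (sigma i / Num.sqrt (npulls h i)%:R) (b ord0 i).

Definition tv_dist (f g : 'rV[R]_p -> R) : \bar R :=
  ((2^-1)%:E * int_Rp (fun b => `|f b - g b|%:E))%E.

(* Expectation E[F(H_m)] of a nonnegative functional of the trajectory when the
   remaining m steps are generated from history h: arm a ~ Lam(h), then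
   y ~ N(beta0_a, sigma_a^2). *)
Fixpoint traj_expect (beta0 : 'rV[R]_p) (sigma : 'I_p -> R)
    (Lam : history -> 'I_p -> R) (m : nat) (F : history -> \bar R)
    (h : history) : \bar R :=
  match m with
  | 0 => F h
  | m'.+1 => \sum_(a < p) ((Lam h a)%:E *
      \int[lebesgue_measure]_y
        ((normal_pdf (beta0 ord0 a) (sigma a) y)%:E *
         traj_expect beta0 sigma Lam m' F (rcons h (a, y))))%E
  end.

Definition traj_prob beta0 sigma Lam (m : nat) (E : set history) : \bar R :=
  traj_expect beta0 sigma Lam m (fun h => (\1_E h)%:E) [::].

Definition sampling_rule (Lam : history -> 'I_p -> R) : Prop :=
  [/\ forall h a, 0 <= Lam h a,
      forall h, \sum_(a < p) Lam h a = 1 &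
      forall (j : nat) (arms : j.-tuple 'I_p) (a : 'I_p),
        measurable_fun setT (fun ys : j.-tuple R => Lam (zip arms ys) a)].

End Bandit.

(* Main.v *)
Require Import Defs.
From HB Require Import structures.
From mathcomp Require Import all_boot all_order all_algebra.
From mathcomp Require Import all_classical all_reals all_analysis.
From mathcomp Require Import measurable_realfun ring lra.
Import Order.TTheory GRing.Theory Num.Theory.
Import numFieldNormedType.Exports.
Local Open Scope classical_set_scope.
Local Open Scope ring_scope.

(** The likelihood is a constant multiple of the Gaussian density [g] of the
    limit law, so with [z] the integral of [prior * g] the total variation
    distance is half the integral of [g * |prior - z| / z].  Continuity at
    [beta0] makes [|prior - prior beta0|] small near [beta0]; away from it, where
    the prior is only bounded, [g] is dominated by an exponentially small
    multiple of a shifted copy of [g].  Hence the distance is at most [eps] as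
    soon as every arm is pulled often enough and all sample means are close to
    [beta0], uniformly over such histories.  That the sample means are close
    follows from the exponential martingale given by the likelihood ratio between
    a shifted and the true mean of one arm: when [N_i > M] and the sample mean
    deviates by [r], one of the two ratios (shifts [r] and [-r]) is at least
    [exp (M r^2 / (2 sigma_i^2))].

    The integral of a nonnegative function is a supremum over simple functions,
    hence monotone without measurability, and subadditive as soon as one of the
    two summands is measurable.  The error terms are explicit
    measurable functions, so the iterated integrals can be bounded one variable
    at a time without Fubini's theorem. *)

Import HBNNSimple.

(** * Monotonicity and subadditivity of integrals of nonnegative functions *)

Section LowerIntegral.
Context (d : measure_display) (T : measurableType d) (R : realType).
Variable mu : {measure set T -> \bar R}.
Local Open Scope ereal_scope.

Lemma ge0_le_lower_integral (f a : T -> \bar R) :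
  (forall x, 0 <= f x) -> (forall x, f x <= a x) ->
  \int[mu]_x f x <= \int[mu]_x a x.
Proof.
move=> f0 fa; have a0 x : 0 <= a x := le_trans (f0 x) (fa x).
rewrite !ge0_integralTE//; apply: ereal_sup_le => _ [h /= hf <-].
by exists h => //= x; exact: le_trans (hf x) (fa x).
Qed.

(** For a simple function [h] below [f], the positive part of [h - g] is measurable and still below
    [a]. Additivity is then applied only to this positive part and [g]. *)
Lemma lower_integral_le_add (f a : T -> \bar R) (g : T -> R) :
  (forall x, 0 <= f x) -> (forall x, 0 <= a x) -> (forall x, (0 <= g x)%R) ->
  measurable_fun setT g ->
  (forall x, f x <= a x + (g x)%:E) ->
  \int[mu]_x f x <= \int[mu]_x a x + \int[mu]_x (g x)%:E.
Proof.
move=> f0 a0 g0 mg fag; rewrite [leLHS]ge0_integralTE//.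
apply: ge_ereal_sup => _ [h /= hf <-]; rewrite -integralT_nnsfun.
pose k x := Num.max (h x - g x)%R 0%R.
have mk : measurable_fun setT k.
  by apply: measurable_maxr => //; apply: measurable_funB.
have k0 x : (0 <= k x)%R by rewrite le_max lexx orbT.
apply: (@le_trans _ _ (\int[mu]_x ((k x)%:E + (g x)%:E))).
  apply: ge0_le_lower_integral => x; rewrite lee_fin //.
  by rewrite -lerBlDr le_max lexx.
rewrite ge0_integralD//; [|by move=> x _; rewrite lee_fin| |
  by move=> x _; rewrite lee_fin|]; last 2 first.
- exact/measurable_EFinP.
- exact/measurable_EFinP.
apply: leeD2r; apply: ge0_le_lower_integral => x; first by rewrite lee_fin.
rewrite /k maxEle; case: ifPn => // _.
by rewrite EFinB leeBlDr//; exact: le_trans (hf x) (fag x).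
Qed.

End LowerIntegral.

(** Each error term is absorbed into [A] in turn. [Phi] is kept abstract so that the same induction
    serves both the iterated integral over parameters and the expectation over trajectories. *)
Lemma functional_le_add_sum (R : realType) (X : Type) (I : Type)
    (Phi : (X -> \bar R) -> \bar R) (s : seq I) (B : I -> X -> R) (c : I -> R) :
  (forall i x, 0 <= B i x) ->
  (forall (F A : X -> \bar R) i, (forall x, 0 <= F x)%E ->
     (forall x, 0 <= A x)%E ->
     (forall x, F x <= A x + (B i x)%:E)%E -> (Phi F <= Phi A + (c i)%:E)%E) ->
  (forall F A : X -> \bar R, (forall x, 0 <= F x)%E ->
     (forall x, F x <= A x)%E -> (Phi F <= Phi A)%E) ->
  forall F A : X -> \bar R, (forall x, 0 <= F x)%E -> (forall x, 0 <= A x)%E ->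
  (forall x, F x <= A x + (\sum_(i <- s) B i x)%:E)%E ->
  (Phi F <= Phi A + (\sum_(i <- s) c i)%:E)%E.
Proof.
move=> B0 add mono; elim: s => [|i s IH] F A F0 A0 FA.
  rewrite big_nil adde0; apply: mono => // x.
  by have := FA x; rewrite big_nil adde0.
pose A' x := (A x + (B i x)%:E)%E.
have A'0 x : (0 <= A' x)%E by rewrite adde_ge0// lee_fin.
apply: (@le_trans _ _ (Phi A' + (\sum_(j <- s) c j)%:E)%E).
  apply: IH => // x; have := FA x.
  by rewrite big_cons EFinD addeA.
by rewrite big_cons EFinD addeA; apply: leeD2r; exact: add.
Qed.

(** * Shifting the mean of a Gaussian density *)

Section NormalPdf.
Context {R : realType}.
Implicit Types m s x r : R.

Lemma normal_pdf_tilt m s r x : s != 0 ->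
  normal_pdf (m + r) s x =
  normal_pdf m s x * expR ((r * (x - m) - r ^+ 2 / 2) / s ^+ 2).
Proof.
move=> s0; rewrite !normal_pdfE// -mulrA -expRD; congr (_ * expR _).
by field.
Qed.

(** The shift [r] is signed: the hypothesis places [x] at distance at least [|r|] from [m], on the
    side of [r]. There the tilting exponent is at least [r ^+ 2 / (2 s ^+ 2)]. *)
Lemma normal_pdf_tail m s r x : s != 0 -> r ^+ 2 <= r * (x - m) ->
  normal_pdf m s x <= expR (- (r ^+ 2 / (s ^+ 2 *+ 2))) * normal_pdf (m + r) s x.
Proof.
move=> s0 rx; rewrite normal_pdf_tilt// mulrCA -expRD ler_peMr ?normal_pdf_ge0//.
rewrite -[leLHS]expR0 ler_expR.
rewrite [leRHS](_ : _ = (r * (x - m) - r ^+ 2) / s ^+ 2); last by field.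
by rewrite divr_ge0 ?subr_ge0 ?sqr_ge0.
Qed.

Lemma integral_normal_pdfZ m s c : s != 0 -> 0 <= c ->
  (\int[lebesgue_measure]_x (c * normal_pdf m s x)%:E = c%:E)%E.
Proof.
move=> s0 c0; under eq_integral do rewrite EFinM.
rewrite ge0_integralZl_EFin//; first by rewrite integral_normal_pdf// mule1.
  by move=> x _; rewrite lee_fin normal_pdf_ge0.
by apply/measurable_EFinP; exact: measurable_normal_pdf.
Qed.

End NormalPdf.

(** * Iterated integrals with Gaussian product errors *)

Section IntCoords.
Context {R : realType} {p : nat}.
Implicit Types (F A : 'rV[R]_p -> \bar R) (v b : 'rV[R]_p) (mu s : 'I_p -> R).

Lemma int_coords_ge0 F k v :
  (forall b, 0 <= F b)%E -> (0 <= int_coords F k v)%E.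
Proof.
by move=> F0; elim: k v => //= k IH v; apply: integral_ge0 => x _; exact: IH.
Qed.

Lemma le_int_coords F A k v : (forall b, 0 <= F b)%E ->
  (forall b, F b <= A b)%E -> (int_coords F k v <= int_coords A k v)%E.
Proof.
move=> F0 FA; elim: k v => //= k IH v.
by apply: ge0_le_lower_integral => x //; exact: int_coords_ge0.
Qed.

Lemma int_coords0 k v : int_coords (fun=> 0%E) k v = 0%E.
Proof. by elim: k v => //= k IH v; apply: integral0_eq => x _; exact: IH. Qed.

Definition normal_prod mu s b := \prod_(i < p) normal_pdf (mu i) (s i) (b ord0 i).

Lemma normal_prod_ge0 mu s b : 0 <= normal_prod mu s b.
Proof. by apply: prodr_ge0 => i _; exact: normal_pdf_ge0. Qed.

(** What remains of the product density once the coordinates below [k] are integrated out; at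
    [k = p] it is the empty product 1. *)
Let marginal mu s k v :=
  \prod_(i < p | (k <= i)%N) normal_pdf (mu i) (s i) (v ord0 i).

Let marginal_ge0 mu s k v : 0 <= marginal mu s k v.
Proof. by apply: prodr_ge0 => i _; exact: normal_pdf_ge0. Qed.

Let marginal_row mu s k v x (kp : (k < p)%N) :
  marginal mu s k (\row_j (if nat_of_ord j == k then x else v ord0 j)) =
  marginal mu s k.+1 v * normal_pdf (mu (Ordinal kp)) (s (Ordinal kp)) x.
Proof.
rewrite /marginal (bigD1 (Ordinal kp))//= mxE eqxx mulrC; congr (_ * _).
apply: eq_big => [i|i /andP[_ ik]].
  by rewrite -val_eqE/= [RHS]ltn_neqAle andbC eq_sym.
by rewrite mxE; rewrite -val_eqE/= in ik; rewrite (negbTE ik).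
Qed.

Let integral_marginal mu s k v (c : R) : (forall i, s i != 0) -> (k < p)%N ->
  0 <= c ->
  (\int[lebesgue_measure]_x (c * marginal mu s k
     (\row_j (if nat_of_ord j == k then x : R else v ord0 j)))%:E =
   (c * marginal mu s k.+1 v)%:E)%E.
Proof.
move=> s0 kp c0; under eq_integral do rewrite (marginal_row _ _ _ _ _ kp) mulrA.
by rewrite integral_normal_pdfZ// mulr_ge0.
Qed.

Lemma int_Rp_normal_prod mu s c : (forall i, s i != 0) -> 0 <= c ->
  int_Rp (fun b => (c * normal_prod mu s b)%:E) = c%:E.
Proof.
move=> s0 c0; suff H k v : (k <= p)%N ->
    int_coords (fun b => (c * normal_prod mu s b)%:E) k v =
    (c * marginal mu s k v)%:E.
  rewrite /int_Rp H// /marginal big_pred0 ?mulr1// => i.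
  by rewrite leqNgt ltn_ord.
elim: k v => [|k IH] v kp //=.
under eq_integral do rewrite IH ?(ltnW kp)//.
by rewrite integral_marginal.
Qed.

(** Induction on the number of integrated coordinates: the error term stays an explicit Gaussian
    marginal, hence measurable in the next variable, whatever [F] and [A] are. *)
Lemma int_Rp_le_add mu s F A c : (forall i, s i != 0) -> 0 <= c ->
  (forall b, 0 <= F b)%E -> (forall b, 0 <= A b)%E ->
  (forall b, F b <= A b + (c * normal_prod mu s b)%:E)%E ->
  (int_Rp F <= int_Rp A + c%:E)%E.
Proof.
move=> s0 c0 F0 A0 FA; suff H k v : (k <= p)%N ->
    (int_coords F k v <= int_coords A k v + (c * marginal mu s k v)%:E)%E.
  have := H p 0 (leqnn p); rewrite /marginal big_pred0 ?mulr1// => i.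
  by rewrite leqNgt ltn_ord.
elim: k v => [|k IH] v kp //=; rewrite -integral_marginal//.
apply: lower_integral_le_add => [x|x|x||x].
- exact: int_coords_ge0.
- exact: int_coords_ge0.
- by rewrite mulr_ge0.
- under eq_fun do rewrite (marginal_row _ _ _ _ _ kp) mulrA.
  by apply: measurable_funM => //; exact: measurable_normal_pdf.
- exact/IH/ltnW.
Qed.

Lemma int_Rp_le_add_sum (I : Type) (r : seq I) (mu : I -> 'I_p -> R) s
    (c : I -> R) F A : (forall i, s i != 0) -> (forall i, 0 <= c i) ->
  (forall b, 0 <= F b)%E -> (forall b, 0 <= A b)%E ->
  (forall b, F b <= A b + (\sum_(i <- r) c i * normal_prod (mu i) s b)%:E)%E ->
  (int_Rp F <= int_Rp A + (\sum_(i <- r) c i)%:E)%E.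
Proof.
move=> s0 c0; apply: functional_le_add_sum => [i b|F1 A1 i|F1 A1].
- by rewrite mulr_ge0 ?normal_prod_ge0.
- exact: int_Rp_le_add.
- exact: le_int_coords.
Qed.

End IntCoords.

(** * Expectations over trajectories and the likelihood-ratio martingale *)

Section Trajectory.
Context {R : realType} {p : nat} (beta0 : 'rV[R]_p) (sigma : 'I_p -> R).
Variable Lam : history R p -> 'I_p -> R.
Hypothesis Lam_ge0 : forall h a, 0 <= Lam h a.
Hypothesis Lam_sum1 : forall h, \sum_(a < p) Lam h a = 1.
Implicit Types (F A : history R p -> \bar R) (h : history R p).

Local Notation T := (traj_expect beta0 sigma Lam).

Lemma traj_expect_ge0 n F h : (forall h, 0 <= F h)%E -> (0 <= T n F h)%E.
Proof.
move=> F0; elim: n h => //= n IH h; apply: sume_ge0 => a _.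
apply: mule_ge0; rewrite ?lee_fin//; apply: integral_ge0 => y _.
by apply: mule_ge0; rewrite ?lee_fin ?normal_pdf_ge0.
Qed.

Lemma le_traj_expect n F A h : (forall h, 0 <= F h)%E ->
  (forall h, F h <= A h)%E -> (T n F h <= T n A h)%E.
Proof.
move=> F0 FA; elim: n h => //= n IH h; apply: lee_sum => a _.
apply: lee_wpmul2l; rewrite ?lee_fin//; apply: ge0_le_lower_integral => y.
  by apply: mule_ge0; rewrite ?lee_fin ?normal_pdf_ge0//; exact: traj_expect_ge0.
by apply: lee_wpmul2l; rewrite ?lee_fin ?normal_pdf_ge0.
Qed.

(** The mean of [B] after one more reward is [B h] whichever arm is pulled. Splitting [B h] with the
    weights [Lam h a], which sum to 1, therefore reduces each step to a single arm, under any
    sampling rule. *)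
Lemma traj_expect_le_add_martingale n F A (B : history R p -> R) h :
  (forall h, 0 <= B h) ->
  (forall h a, measurable_fun setT (fun y : R => B (rcons h (a, y)))) ->
  (forall h a, \int[lebesgue_measure]_y
     (normal_pdf (beta0 ord0 a) (sigma a) y * B (rcons h (a, y)))%:E =
     (B h)%:E)%E ->
  (forall h, 0 <= F h)%E -> (forall h, 0 <= A h)%E ->
  (forall h, F h <= A h + (B h)%:E)%E ->
  (T n F h <= T n A h + (B h)%:E)%E.
Proof.
move=> B0 mB intB F0 A0 FA; elim: n h => //= n IH h.
rewrite -[B h]mul1r -(Lam_sum1 h) mulr_suml -sumEFin -big_split/=.
apply: lee_sum => a _; rewrite EFinM -ge0_muleDr ?lee_fin//; last first.
  apply: integral_ge0 => y _; apply: mule_ge0; rewrite ?lee_fin ?normal_pdf_ge0//.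
  exact: traj_expect_ge0.
apply: lee_wpmul2l; rewrite ?lee_fin// -(intB h a).
apply: lower_integral_le_add => [y|y|y||y].
- by apply: mule_ge0; rewrite ?lee_fin ?normal_pdf_ge0//; exact: traj_expect_ge0.
- by apply: mule_ge0; rewrite ?lee_fin ?normal_pdf_ge0//; exact: traj_expect_ge0.
- by rewrite mulr_ge0 ?normal_pdf_ge0.
- by apply: measurable_funM; [exact: measurable_normal_pdf|exact: mB].
- rewrite EFinM -ge0_muleDr ?lee_fin//; last exact: traj_expect_ge0.
  by apply: lee_wpmul2l; rewrite ?lee_fin ?normal_pdf_ge0.
Qed.

(* The likelihood ratio of the rewards of arm [i] between the means
   [beta0_i + r] and [beta0_i]. *)
Definition shift_ratio (i : 'I_p) (r : R) h :=
  \prod_(x <- h | x.1 == i)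
    expR ((r * (x.2 - beta0 ord0 i) - r ^+ 2 / 2) / sigma i ^+ 2).

Lemma shift_ratio_ge0 i r h : 0 <= shift_ratio i r h.
Proof. by apply: prodr_ge0 => x _; exact: expR_ge0. Qed.

Lemma shift_ratio_rcons i r h a y : shift_ratio i r (rcons h (a, y)) =
  shift_ratio i r h * if a == i then
    expR ((r * (y - beta0 ord0 i) - r ^+ 2 / 2) / sigma i ^+ 2) else 1.
Proof. by rewrite /shift_ratio big_rcons. Qed.

Lemma measurable_shift_ratio_rcons i r h a :
  measurable_fun setT (fun y : R => shift_ratio i r (rcons h (a, y))).
Proof.
under eq_fun do rewrite shift_ratio_rcons.
apply: measurable_funM => //; case: (a == i) => //.
apply: measurableT_comp => //; apply: measurable_funM => //.
apply: measurable_funB => //; apply: measurable_funM => //.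
exact: measurable_funB.
Qed.

(** If arm [i] is pulled, the new factor turns the reward density into the one with mean shifted by
    [r], which still has mass 1; for any other arm the factor is 1. *)
Lemma integral_shift_ratio_rcons i r h a : (forall i, 0 < sigma i) ->
  (\int[lebesgue_measure]_y (normal_pdf (beta0 ord0 a) (sigma a) y *
     shift_ratio i r (rcons h (a, y)))%:E = (shift_ratio i r h)%:E)%E.
Proof.
move=> sigma_gt0; have sn0 j : sigma j != 0 by rewrite gt_eqF.
pose m := beta0 ord0 a + if a == i then r else 0.
under eq_integral => y _.
  rewrite (_ : _ * _ = shift_ratio i r h * normal_pdf m (sigma a) y); last first.
    rewrite shift_ratio_rcons mulrCA /m; case: eqP => [->|_].
      by rewrite -normal_pdf_tilt.
    by rewrite mulr1 addr0.
  over.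
by rewrite integral_normal_pdfZ// shift_ratio_ge0.
Qed.

(** Every ratio equals 1 on the empty history, so the martingale with weight [c i] costs exactly
    [c i]. *)
Lemma traj_expect_le_add_sum (I : Type) (l : seq I) (k : I -> 'I_p)
    (r c : I -> R) n F A : (forall i, 0 < sigma i) -> (forall i, 0 <= c i) ->
  (forall h, 0 <= F h)%E -> (forall h, 0 <= A h)%E ->
  (forall h, F h <= A h +
     (\sum_(i <- l) c i * shift_ratio (k i) (r i) h)%:E)%E ->
  (T n F [::] <= T n A [::] + (\sum_(i <- l) c i)%:E)%E.
Proof.
move=> sigma_gt0 c0; apply: (@functional_le_add_sum _ _ _ (fun G => T n G [::])).
- by move=> i h; rewrite mulr_ge0 ?shift_ratio_ge0.
- move=> F1 A1 i F10 A10 FA1.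
  have W1 : c i = c i * shift_ratio (k i) (r i) [::].
    by rewrite /shift_ratio big_nil mulr1.
  rewrite [X in (_ + X%:E)%E]W1; apply: (@traj_expect_le_add_martingale _ _ _
    (fun h => c i * shift_ratio (k i) (r i) h)) => //.
  + by move=> h; rewrite mulr_ge0 ?shift_ratio_ge0.
  + move=> h a; apply: measurable_funM => //.
    exact: measurable_shift_ratio_rcons.
  + move=> h a; under eq_integral do rewrite mulrCA EFinM.
    rewrite ge0_integralZl_EFin//; first by rewrite integral_shift_ratio_rcons.
      by move=> y _; rewrite lee_fin mulr_ge0 ?normal_pdf_ge0 ?shift_ratio_ge0.
    apply/measurable_EFinP; apply: measurable_funM.
      exact: measurable_normal_pdf.
    exact: measurable_shift_ratio_rcons.
- by move=> F1 A1; exact: le_traj_expect.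
Qed.

End Trajectory.

(** * Sufficiency of pull counts and sample means *)

Section History.
Context {R : realType} {p : nat}.
Implicit Types (h : history R p) (i : 'I_p) (sigma : 'I_p -> R).

Lemma sumr_const_npulls h i (c : R) :
  \sum_(x <- h | x.1 == i) c = (npulls h i)%:R * c.
Proof. by rewrite big_const_seq iter_addr_0 mulr_natl. Qed.

Lemma sum_dev_sample_mean h i (c : R) : (0 < npulls h i)%N ->
  \sum_(x <- h | x.1 == i) (x.2 - c) = (npulls h i)%:R * (sample_mean h i - c).
Proof.
move=> N0; rewrite sumrB sumr_const_npulls mulrBr; congr (_ - _).
by rewrite /sample_mean mulrC divfK// pnatr_eq0 -lt0n.
Qed.

Lemma sum_sqr_dev_sample_mean h i (c : R) : (0 < npulls h i)%N ->
  \sum_(x <- h | x.1 == i) (x.2 - c) ^+ 2 =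
  (npulls h i)%:R * (c - sample_mean h i) ^+ 2 +
  \sum_(x <- h | x.1 == i) (x.2 - sample_mean h i) ^+ 2.
Proof.
move=> N0; set m := sample_mean h i.
have -> : \sum_(x <- h | x.1 == i) (x.2 - c) ^+ 2 =
    \sum_(x <- h | x.1 == i)
      ((c - m) ^+ 2 + (2 * (m - c) * (x.2 - m) + (x.2 - m) ^+ 2)).
  by apply: eq_bigr => x _; ring.
rewrite !big_split/= sumr_const_npulls -mulr_sumr sum_dev_sample_mean// -/m.
by rewrite subrr !mulr0 add0r.
Qed.

(** Grouped by arm, the squared deviations split into a term quadratic in [b] around the sample mean
    and a residual free of [b]. The residuals and the normalising peaks make up [K]. *)
Lemma likelihood_gauss_approx sigma h : (forall i, 0 < sigma i) ->
  (forall i, (0 < npulls h i)%N) ->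
  exists2 K : R, 0 < K &
    forall b, likelihood sigma h b = K * gauss_approx sigma h b.
Proof.
move=> sigma_gt0 N0; pose s i := sigma i / Num.sqrt (npulls h i)%:R.
have s0 i : s i != 0.
  by rewrite gt_eqF// divr_gt0// sqrtr_gt0 ltr0n.
pose K i := expR (- (\sum_(x <- h | x.1 == i) (x.2 - sample_mean h i) ^+ 2) /
  (sigma i ^+ 2 *+ 2)) / normal_peak (s i).
exists (\prod_i K i) => [|b].
  by apply: prodr_gt0 => i _; rewrite divr_gt0 ?expR_gt0 ?normal_peak_gt0.
rewrite /likelihood (partition_big (fun x => x.1) xpredT)//=.
rewrite /gauss_approx -big_split/=; apply: eq_bigr => i _.
rewrite -/(s i) normal_pdfE// /K -mulrA mulKf ?gt_eqF ?normal_peak_gt0//.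
rewrite /normal_fun -expRD.
rewrite [RHS](_ : _ = expR (\sum_(x <- h | x.1 == i)
  - (x.2 - b ord0 i) ^+ 2 / (sigma i ^+ 2 *+ 2))); last first.
  congr expR; rewrite -mulr_suml sumrN (sum_sqr_dev_sample_mean _ _ (b ord0 i))//.
  rewrite /s expr_div_n sqr_sqrtr ?ler0n//.
  field; rewrite (gt_eqF (sigma_gt0 i))/= pnatr_eq0 -lt0n; exact: N0.
by rewrite expR_sum; apply: eq_bigr => x /eqP ->.
Qed.

Lemma shift_ratioE (beta0 : 'rV[R]_p) sigma h i r : (0 < npulls h i)%N ->
  shift_ratio beta0 sigma i r h =
  expR ((npulls h i)%:R *
    ((r * (sample_mean h i - beta0 ord0 i) - r ^+ 2 / 2) / sigma i ^+ 2)).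
Proof.
move=> N0; rewrite /shift_ratio -expR_sum; congr expR.
rewrite -mulr_suml mulrA; congr (_ / _).
rewrite sumrB sumr_const_npulls -mulr_sumr sum_dev_sample_mean//.
by ring.
Qed.

(** The deviation makes each pull contribute at least [r ^+ 2 / (2 sigma_i ^+ 2)] on average to the
    log-ratio, and there are more than [M] pulls. *)
Lemma shift_ratio_tail (beta0 : 'rV[R]_p) sigma h i r M : 0 < sigma i ->
  (M < npulls h i)%N -> r ^+ 2 <= r * (sample_mean h i - beta0 ord0 i) ->
  1 <= expR (- (M%:R * (r ^+ 2 / (sigma i ^+ 2 *+ 2)))) *
       shift_ratio beta0 sigma i r h.
Proof.
move=> sigma_gt0 MN rm; rewrite shift_ratioE ?(leq_ltn_trans _ MN)// -expRD.
rewrite -[leLHS]expR0 ler_expR.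
set k := r ^+ 2 / (sigma i ^+ 2 *+ 2).
have k0 : 0 <= k by rewrite divr_ge0 ?mulrn_wge0 ?sqr_ge0.
have kle : k <= (r * (sample_mean h i - beta0 ord0 i) - r ^+ 2 / 2) / sigma i ^+ 2.
  rewrite (_ : k = r ^+ 2 / 2 / sigma i ^+ 2); last by rewrite /k; field; rewrite gt_eqF.
  by rewrite ler_wpM2r ?invr_ge0 ?sqr_ge0//; lra.
rewrite addrC subr_ge0 ler_pM ?ler0n// ler_nat; exact: ltnW.
Qed.

End History.

Lemma near_expRN_le (R : realType) (c e : R) : 0 < c -> 0 < e ->
  \forall M \near \oo, expR (- (M%:R * c)) <= e.
Proof.
move=> c0 e0; near=> M.
rewrite expRN -[e]invrK lef_pV2 ?posrE ?expR_gt0 ?invr_gt0//.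
(* This size of [M] suffices because [expR (M c)] is at least [1 + M c]. *)
have : (e * c)^-1 <= M%:R by near: M; exact: nbhs_infty_ger.
rewrite invfM -ler_pdivlMr ?invr_gt0// invrK => h.
by apply: (le_trans h); apply: le_trans (expR_ge1Dx _); rewrite lerDr.
Unshelve. all: by end_near. Qed.

(** * Total variation bound for a fixed history *)

Section Posterior.
Context {R : realType} {p : nat}.
Implicit Types (m s : 'I_p -> R) (q : 'I_p * bool) (b : 'rV[R]_p).

(** [true] stands for the negative direction, so a pair in ['I_p * bool] names one of the [2p]
    half-spaces that cover the complement of a cube. *)
Definition sgn_shift (r : R) (e : bool) : R := if e then - r else r.

Definition shift_mean m (r : R) q : 'I_p -> R :=
  fun j => m j + if j == q.1 then sgn_shift r q.2 else 0.

Lemma normal_prod_tail m s r q b : (forall i, s i != 0) ->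
  r ^+ 2 <= sgn_shift r q.2 * (b ord0 q.1 - m q.1) ->
  normal_prod m s b <=
  expR (- (r ^+ 2 / (s q.1 ^+ 2 *+ 2))) * normal_prod (shift_mean m r q) s b.
Proof.
move=> s0 rb; rewrite /normal_prod (bigD1 q.1)//= [in leRHS](bigD1 q.1)//= mulrA.
rewrite (eq_bigr (fun i => normal_pdf (shift_mean m r q i) (s i) (b ord0 i)));
  last by move=> i /negbTE iq; rewrite /shift_mean iq addr0.
apply: ler_wpM2r; first by apply: prodr_ge0 => i _; exact: normal_pdf_ge0.
have r2 : r ^+ 2 = sgn_shift r q.2 ^+ 2 by rewrite /sgn_shift; case: q.2; rewrite ?sqrrN.
by rewrite /shift_mean eqxx r2; apply: normal_pdf_tail => //; rewrite -r2.
Qed.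

Lemma sgn_shift_exists (r t : R) : 0 <= r -> r <= `|t| ->
  exists e, r ^+ 2 <= sgn_shift r e * t.
Proof.
move=> r0 rt; exists (t < 0); rewrite /sgn_shift.
case: ltrP => t0; [rewrite ltr0_norm// in rt|rewrite ger0_norm// in rt].
  by rewrite mulNr -mulrN expr2 ler_wpM2l.
by rewrite expr2 ler_wpM2l.
Qed.

Lemma int_Rp_le_add_mixture m s r (c0 : R) (c : 'I_p * bool -> R)
    (F A : 'rV[R]_p -> \bar R) : (forall i, s i != 0) ->
  0 <= c0 -> (forall q, 0 <= c q) ->
  (forall b, 0 <= F b)%E -> (forall b, 0 <= A b)%E ->
  (forall b, F b <= A b + (c0 * normal_prod m s b +
     \sum_q c q * normal_prod (shift_mean m r q) s b)%:E)%E ->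
  (int_Rp F <= int_Rp A + (c0 + \sum_q c q)%:E)%E.
Proof.
move=> s0 c00 c_ge0 F0 A0 FA.
(* [None] indexes the unshifted Gaussian and [Some q] the shifted copies. *)
pose l := None :: [seq Some q | q <- index_enum ('I_p * bool)%type].
have lE (f : option ('I_p * bool) -> R) :
    \sum_(t <- l) f t = f None + \sum_q f (Some q).
  by rewrite big_cons big_map.
have := @int_Rp_le_add_sum R p _ l
  (fun t => if t is Some q then shift_mean m r q else m) s
  (fun t => if t is Some q then c q else c0) F A s0.
rewrite lE; apply=> // [[q|]//|b].
by rewrite lE; exact: FA.
Qed.

(** [u] bounds the integral of [|prior - pi0|] against the Gaussian: [eta] inside the cube, Gaussian
    tails times [C] outside. The normalising constant is then within [u] of [pi0], and the triangle
    inequality through [pi0] bounds the L1 distance by [2 u / (pi0 - u)], which the factor one half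
    in the distance turns into the claim. *)
Lemma tv_dist_posterior_le (prior : 'rV[R]_p -> R) (sigma : 'I_p -> R)
    (h : history R p) (pi0 C eta r : R)
    (u := eta + \sum_(q : 'I_p * bool)
       C * expR (- ((npulls h q.1)%:R * (r ^+ 2 / (sigma q.1 ^+ 2 *+ 2))))) :
  (forall i, 0 < sigma i) -> (forall i, (0 < npulls h i)%N) ->
  (forall b, 0 <= prior b <= C) -> 0 <= pi0 <= C -> 0 <= eta -> 0 <= r ->
  (forall b, (forall i, `|b ord0 i - sample_mean h i| < r) ->
     `|prior b - pi0| <= eta) ->
  u < pi0 ->
  (tv_dist (posterior prior sigma h) (gauss_approx sigma h) <=
   (u / (pi0 - u))%:E)%E.
Proof.
move=> sigma_gt0 N0 prior_bd pi0_bd eta0 r0 near_pi0 u_lt.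
have [K K0 LE] := likelihood_gauss_approx _ _ sigma_gt0 N0.
pose s i := sigma i / Num.sqrt (npulls h i)%:R.
have s0 i : s i != 0 by rewrite gt_eqF// divr_gt0// sqrtr_gt0 ltr0n.
pose m i := sample_mean h i.
pose e (q : 'I_p * bool) :=
  C * expR (- ((npulls h q.1)%:R * (r ^+ 2 / (sigma q.1 ^+ 2 *+ 2)))).
have C0 : 0 <= C by case/andP: pi0_bd; exact: le_trans.
have e0 q : 0 <= e q by rewrite mulr_ge0 ?expR_ge0.
pose g := normal_prod m s.
have g0 b : 0 <= g b := normal_prod_ge0 _ _ _.
have gE : gauss_approx sigma h = g by [].
pose S b := \sum_q e q * normal_prod (shift_mean m r q) s b.
have S0 b : 0 <= S b.
  by apply: sumr_ge0 => q _; rewrite mulr_ge0 ?normal_prod_ge0.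
have dev b : `|prior b - pi0| * g b <= eta * g b + S b.
  have [near_b|] := pselect (forall i, `|b ord0 i - m i| < r).
    by rewrite ler_wpDr// ler_wpM2r// near_pi0.
  (* Outside the cube some coordinate [i] is off by at least [r]. The term of [S] for that arm and
     side alone dominates, as [|prior b - pi0|] is at most [C]. *)
  move=> /existsNP[i /negP]; rewrite -leNgt => far.
  have [eps reps] := sgn_shift_exists _ _ r0 far.
  pose q := (i, eps).
  rewrite ler_wpDl ?mulr_ge0//.
  apply: (@le_trans _ _ (e q * normal_prod (shift_mean m r q) s b)).
    rewrite /e -mulrA; apply: ler_pM => //.
      have /andP[? ?] := prior_bd b; case/andP: pi0_bd => ? ?.
      by rewrite ler_norml; apply/andP; split; lra.
    rewrite [X in expR (- X)](_ : _ = r ^+ 2 / (s q.1 ^+ 2 *+ 2)).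
      exact: normal_prod_tail.
    rewrite /s expr_div_n sqr_sqrtr ?ler0n//; field.
    by rewrite (gt_eqF (sigma_gt0 _))/= pnatr_eq0 -lt0n N0.
  rewrite /S (bigD1 q)//= lerDl; apply: sumr_ge0 => j _.
  by rewrite mulr_ge0 ?normal_prod_ge0.
have scaleS (k : R) b : k * S b =
    \sum_q (k * e q) * normal_prod (shift_mean m r q) s b.
  by rewrite mulr_sumr; apply: eq_bigr => q _; rewrite mulrA.
have uE : u = eta + \sum_q e q by [].
have u0 : 0 <= u by rewrite uE addr_ge0 ?sumr_ge0.
pose PL b := prior b * likelihood sigma h b.
have PL0 b : (0 <= (PL b)%:E)%E.
  by rewrite lee_fin /PL LE; case/andP: (prior_bd b) => ? _; rewrite !mulr_ge0 ?gE// ltW.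
have devK b : `|PL b - pi0 * K * g b| <= K * (eta * g b + S b).
  rewrite /PL LE gE (_ : _ - _ = K * ((prior b - pi0) * g b)); last by ring.
  by rewrite normrM (gtr0_norm K0) ler_pM2l// normrM (ger0_norm (g0 b)).
have [pi00 _] := andP pi0_bd.
have up : (int_Rp (fun b => (PL b)%:E) <= (pi0 * K + K * u)%:E)%E.
  have := @int_Rp_le_add_mixture m s r (pi0 * K + K * eta) (fun q => K * e q)
    (fun b => (PL b)%:E) (fun=> 0%E) s0.
  rewrite /int_Rp int_coords0 add0e uE mulrDr addrA mulr_sumr; apply=> //.
  - by rewrite addr_ge0 ?mulr_ge0// ltW.
  - by move=> q; rewrite mulr_ge0// ltW.
  - move=> b; rewrite add0e lee_fin -scaleS -/(g b).
    by have := devK b; rewrite ler_norml => /andP[_]; lra.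
(* The lower bound uses subadditivity with the roles exchanged: the exact Gaussian is bounded by the
   unnormalised posterior plus the error. *)
have low : ((pi0 * K)%:E <= int_Rp (fun b => (PL b)%:E) + (K * u)%:E)%E.
  have := @int_Rp_le_add_mixture m s r (K * eta) (fun q => K * e q)
    (fun b => (pi0 * K * g b)%:E) (fun b => (PL b)%:E) s0.
  rewrite int_Rp_normal_prod ?mulr_ge0 ?(ltW K0)// uE mulrDr mulr_sumr.
  apply=> //.
  - by move=> q; rewrite mulr_ge0// ltW.
  - by move=> b; rewrite lee_fin !mulr_ge0// ltW.
  - move=> b; rewrite -EFinD lee_fin -scaleS -/(g b).
    by have := devK b; rewrite ler_norml => /andP[+ _]; lra.
have intPL0 : (0 <= int_Rp (fun b => (PL b)%:E))%E by exact: int_coords_ge0.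
(* Finiteness makes [fine] faithful in [posterior]; on an infinite integral it would return 0. *)
have Zfin : int_Rp (fun b => (PL b)%:E) \is a fin_num.
  by rewrite ge0_fin_numE// (le_lt_trans up)// ltry.
pose Z := fine (int_Rp (fun b => (PL b)%:E)).
rewrite -(fineK Zfin) -/Z -?EFinD !lee_fin in up low.
(* [z] is the integral of the prior against the Gaussian; the factor [K] cancels in the
   posterior. *)
pose z := Z / K.
have ZE : Z = z * K by rewrite /z divfK ?gt_eqF.
have zup : z <= pi0 + u.
  by rewrite -(ler_pM2r K0) -ZE (le_trans up)//; lra.
have zlow : pi0 <= z + u.
  by rewrite -(ler_pM2r K0) mulrDl -ZE (le_trans low)//; lra.
have z0 : 0 < z by lra.
have bound : (int_Rp (fun b => `|posterior prior sigma h b - gauss_approx sigma h b|%:E)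
    <= ((u + `|pi0 - z|) / z)%:E)%E.
  have := @int_Rp_le_add_mixture m s r ((eta + `|pi0 - z|) / z) (fun q => z^-1 * e q)
    (fun b => `|posterior prior sigma h b - gauss_approx sigma h b|%:E) (fun=> 0%E) s0.
  rewrite /int_Rp int_coords0 add0e uE (_ : (_ / z) + _ =
    (eta + \sum_q e q + `|pi0 - z|) / z); last by rewrite -mulr_sumr; ring.
  apply=> //.
  - by rewrite divr_ge0 ?addr_ge0// ltW.
  - by move=> q; rewrite mulr_ge0// invr_ge0 ltW.
  - move=> b; rewrite add0e lee_fin -scaleS -/(g b) /posterior -/(PL b) -/Z gE.
    rewrite (_ : _ - _ = z^-1 * ((prior b - z) * g b)); last first.
      by rewrite /PL LE gE ZE; field; rewrite !gt_eqF.
    rewrite normrM gtr0_norm ?invr_gt0// normrM (ger0_norm (g0 b)).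
    rewrite [leRHS](_ : _ = z^-1 * (eta * g b + S b + `|pi0 - z| * g b)); last by ring.
    rewrite ler_pM2l ?invr_gt0//.
    apply: (@le_trans _ _ (`|prior b - pi0| * g b + `|pi0 - z| * g b)).
      rewrite -mulrDl ler_wpM2r// (le_trans _ (ler_normD _ _))//.
      by rewrite addrA subrK.
    by rewrite lerD2r dev.
rewrite /tv_dist.
apply: (@le_trans _ _ ((2^-1)%:E * ((u + `|pi0 - z|) / z)%:E)%E).
  by apply: lee_wpmul2l => //; rewrite lee_fin invr_ge0.
rewrite -EFinM lee_fin mulrC ler_pdivrMr//.
have dz : `|pi0 - z| <= u by rewrite ler_norml; apply/andP; split; lra.
apply: (@le_trans _ _ (2 * u / (pi0 - u))); last by rewrite [leRHS]mulrC mulrA.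
apply: ler_pM; rewrite ?(addr_ge0 u0) ?invr_ge0 ?(ltW z0)//; first by lra.
by rewrite lef_pV2 ?posrE//; lra.
Qed.

End Posterior.

Lemma ge0_cvge0P (R : realType) (f : nat -> \bar R) : (forall n, 0 <= f n)%E ->
  f @ \oo --> 0%E <->
  forall e : R, 0 < e -> \forall n \near \oo, (f n <= e%:E)%E.
Proof.
move=> f0; split=> [/(fine_cvgP _ 0)[ffin /cvgrPdist_le f_cvg] e e0|f_le].
  near=> n; have fn_fin : f n \is a fin_num by near: n.
  rewrite -(fineK fn_fin) lee_fin (le_trans (ler_norm _))//.
  by rewrite -normrN -sub0r; near: n; exact: f_cvg.
apply/(fine_cvgP _ 0); split.
  near=> n; rewrite ge0_fin_numE// (@le_lt_trans _ _ 1%:E) ?ltry//.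
  by near: n; exact: f_le.
apply/cvgrPdist_le => e e0; near=> n.
rewrite sub0r normrN/= ger0_norm ?fine_ge0// -lee_fin.
have fne : (f n <= e%:E)%E by near: n; exact: f_le.
by rewrite fineK// ge0_fin_numE// (le_lt_trans fne)// ltry.
Unshelve. all: by end_near. Qed.

(** * Concentration of the sample means under adaptive sampling *)

Section Concentration.
Context {R : realType} {p : nat} (beta0 : 'rV[R]_p) (sigma : 'I_p -> R).

Lemma traj_prob_ge0 (Lam : history R p -> 'I_p -> R) n E :
  (forall h a, 0 <= Lam h a) -> (0 <= traj_prob beta0 sigma Lam n E)%E.
Proof. by move=> L0; apply: traj_expect_ge0 => // h; rewrite lee_fin. Qed.

(** On [E], either some arm has at most [M] pulls or some sample mean is off by [r]; in the second
    case one of the [2p] damped likelihood ratios is at least 1. The indicator of [E] is thus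
    dominated pointwise by terms whose expectations are controlled. *)
Lemma traj_prob_le_deviation (Lam : history R p -> 'I_p -> R) n E M (r : R) :
  (forall i, 0 < sigma i) -> sampling_rule Lam -> 0 <= r ->
  (forall h, E h -> (forall i, (M < npulls h i)%N) ->
     exists i, r <= `|sample_mean h i - beta0 ord0 i|) ->
  (traj_prob beta0 sigma Lam n E <=
   traj_prob beta0 sigma Lam n [set h | exists i, (npulls h i <= M)%N] +
   (\sum_(q : 'I_p * bool)
      expR (- (M%:R * (r ^+ 2 / (sigma q.1 ^+ 2 *+ 2)))))%:E)%E.
Proof.
move=> sigma_gt0 [L0 L1 _] r0 Edev.
have B0 h (q : 'I_p * bool) :
    0 <= expR (- (M%:R * (r ^+ 2 / (sigma q.1 ^+ 2 *+ 2)))) *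
      shift_ratio beta0 sigma q.1 (sgn_shift r q.2) h.
  by rewrite mulr_ge0 ?expR_ge0 ?shift_ratio_ge0.
apply: (@traj_expect_le_add_sum R p beta0 sigma Lam L0 L1 _ _
  (fun q : 'I_p * bool => q.1) (fun q => sgn_shift r q.2)
  (fun q => expR (- (M%:R * (r ^+ 2 / (sigma q.1 ^+ 2 *+ 2)))))) => //.
move=> h; rewrite -EFinD lee_fin.
have sum0 := sumr_ge0 _ (fun q (_ : true) => B0 h q).
have [Eh|nEh] := pselect (E h); last first.
  by rewrite indicE (memNset nEh) addr_ge0.
rewrite [leLHS]indicE (mem_set Eh).
set A := [set h0 | _]; have [few|many] := pselect (A h).
  by rewrite indicE (mem_set few)/= lerDl.
have N_gt i : (M < npulls h i)%N.
  by rewrite ltnNge; apply/negP => le_NM; apply: many; exists i.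
have [i dev_i] := Edev h Eh N_gt.
have [e re] := sgn_shift_exists _ _ r0 dev_i.
rewrite ler_wpDl// (bigD1 (i, e))//= ler_wpDr//; first exact: sumr_ge0.
have r2 : r ^+ 2 = sgn_shift r e ^+ 2.
  by rewrite /sgn_shift; case: (e); rewrite ?sqrrN.
by rewrite r2; apply: shift_ratio_tail => //; rewrite -r2.
Qed.

End Concentration.

(** * Uniform smallness over good histories and conclusion *)

Lemma continuous_rV_at (R : realType) (p : nat) (f : 'rV[R]_p -> R)
    (x : 'rV[R]_p) (e : R) :
  {for x, continuous f} -> 0 < e ->
  exists2 r : R, 0 < r & forall y : 'rV[R]_p,
    (forall i, `|y ord0 i - x ord0 i| < r) -> `|f y - f x| <= e.
Proof.
move=> /cvgrPdist_le/(_ e) + e0 => /(_ e0)/nbhs_ballP[r /= r0 Hr].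
(* Balls of row vectors are cubes, so coordinatewise closeness is membership in the ball. *)
exists r => // y xy; rewrite distrC; apply: Hr; split=> // i j.
by rewrite ord1 /ball/= distrC.
Qed.

Lemma tv_dist_posterior_small (R : realType) (p : nat) (beta0 : 'rV[R]_p)
    (sigma : 'I_p -> R) (prior : 'rV[R]_p -> R) (C eps : R) :
  (forall i, 0 < sigma i) -> (forall b, 0 <= prior b <= C) ->
  {for beta0, continuous prior} -> 0 < prior beta0 -> 0 < eps ->
  exists2 r : R, 0 < r & \forall M \near \oo, forall h : history R p,
    (forall i, (M < npulls h i)%N) ->
    (forall i, `|sample_mean h i - beta0 ord0 i| < r) ->
    (tv_dist (posterior prior sigma h) (gauss_approx sigma h) <= eps%:E)%E.
Proof.
move=> sigma_gt0 prior_bd cont pi0_gt0 eps0; set pi0 := prior beta0.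
have C0 : 0 < C by case/andP: (prior_bd beta0) => _; exact: lt_le_trans.
(* This is the solution of [u / (pi0 - u) = eps]. *)
pose u := pi0 * eps / (1 + eps).
have eps1 : 0 < 1 + eps by lra.
have u0 : 0 < u by rewrite divr_gt0 ?mulr_gt0.
have ueps : u * (1 + eps) = pi0 * eps by rewrite divfK ?gt_eqF.
have u2 : 0 < u / 2 by lra.
have [r r0 near_r] := continuous_rV_at _ _ _ _ _ cont u2.
(* One half of [r] is for the distance from [b] to the sample mean, the other for that from the
   sample mean to [beta0]. Likewise [u] is split between continuity and tails. *)
exists (r / 2); first by lra.
have r20 : 0 < r / 2 by lra.
pose k (i : 'I_p) := (r / 2) ^+ 2 / (sigma i ^+ 2 *+ 2).
have k0 i : 0 < k i by rewrite divr_gt0 ?pmulrn_lgt0 ?exprn_gt0.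
(* The tail budget is shared among all pairs of arm and side; the successor keeps the divisor
   positive when [p = 0]. *)
pose e1 := u / 2 / (C * (#|{: 'I_p * bool}|.+1)%:R).
have e10 : 0 < e1 by rewrite divr_gt0// mulr_gt0// ltr0n.
have : \forall M \near \oo, forall i, expR (- (M%:R * k i)) <= e1.
  by apply: filter_forall => i; exact: near_expRN_le.
apply: filterS => M expM h N_gt dev.
have N0 i : (0 < npulls h i)%N by exact: leq_ltn_trans (N_gt i).
have sum_le : \sum_(q : 'I_p * bool)
    C * expR (- ((npulls h q.1)%:R * k q.1)) <= u / 2.
  apply: (@le_trans _ _ (\sum_(q : 'I_p * bool) C * e1)).
    apply: ler_sum => q _; rewrite ler_pM2l//; apply: le_trans (expM q.1).
    by rewrite ler_expR lerN2 ler_pM2r// ler_nat ltnW.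
  rewrite sumr_const -[leLHS]mulr_natr.
  have <- : C * e1 * (#|{: 'I_p * bool}|.+1)%:R = u / 2.
    by rewrite mulrAC mulrC /e1 divfK// gt_eqF// mulr_gt0// ltr0n.
  by rewrite ler_wpM2l ?ler_nat// mulr_ge0// ltW.
set w := u / 2 + \sum_(q : 'I_p * bool) C * expR (- ((npulls h q.1)%:R * k q.1)).
have wu : w <= u by rewrite /w; lra.
have u_lt : u < pi0 by nra.
have w_lt : w < pi0 by exact: le_lt_trans u_lt.
apply: (@le_trans _ _ (w / (pi0 - w))%:E).
  apply: tv_dist_posterior_le => //; [exact: prior_bd|exact: ltW|exact: ltW|].
  move=> b near_b; apply: near_r => i; have := near_b i; have := dev i.
  have := ler_distD (sample_mean h i) (b ord0 i) (beta0 ord0 i); lra.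
by rewrite lee_fin ler_pdivrMr; nra.
Qed.

Theorem mainTheorem9 (R : realType) (p : nat)
  (beta0 : 'rV[R]_p) (sigma : 'I_p -> R)
  (Lam : nat -> history R p -> 'I_p -> R) (m : nat -> nat)
  (prior : 'rV[R]_p -> R) :
  (forall i, 0 < sigma i) ->
  (forall n, sampling_rule (Lam n)) ->
  (* (i) min_i N_{i,n} -> infinity in probability *)
  (forall M : nat,
     (fun n => traj_prob beta0 sigma (Lam n) (m n)
                 [set h | exists i, (npulls h i <= M)%N]) @ \oo --> 0%E) ->
  (* (ii) continuous bounded prior density, positive at beta0 *)
  (forall b, 0 <= prior b) ->
  int_Rp (fun b => (prior b)%:E) = 1%E ->
  continuous prior ->
  (exists C : R, forall b, prior b <= C) ->
  0 < prior beta0 ->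
  forall eps : R, 0 < eps ->
    (fun n => traj_prob beta0 sigma (Lam n) (m n)
       [set h | (eps%:E < tv_dist (posterior prior sigma h)
                                  (gauss_approx sigma h))%E]) @ \oo --> 0%E.
Proof.
move=> sigma_gt0 rule pulls prior0 _ cont [C prior_le] pi0_gt0 eps eps0.
have L0 n : forall h a, 0 <= Lam n h a by case: (rule n).
have prior_bd b : 0 <= prior b <= C by rewrite prior0 prior_le.
have [r r0 tv_small] := tv_dist_posterior_small _ _ _ _ _ _ _
  sigma_gt0 prior_bd (cont beta0) pi0_gt0 eps0.
apply/ge0_cvge0P => [n|e e0]; first exact: traj_prob_ge0.
pose k (i : 'I_p) := r ^+ 2 / (sigma i ^+ 2 *+ 2).
pose e1 := e / 2 / (#|{: 'I_p * bool}|.+1)%:R.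
have e10 : 0 < e1 by rewrite !divr_gt0// ltr0n.
have exp_small : \forall M \near \oo, forall i, expR (- (M%:R * k i)) <= e1.
  apply: filter_forall => i; apply: near_expRN_le => //.
  by rewrite divr_gt0 ?pmulrn_lgt0 ?exprn_gt0.
(* A single [M], fixed before [n], makes the distance small on good histories and the deviation
   probability at most [e / 2]; the other [e / 2] is left for histories with a rarely pulled arm. *)
have [M [tvM expM]] := filter_ex (filterI tv_small exp_small).
have sum_le : \sum_(q : 'I_p * bool) expR (- (M%:R * k q.1)) <= e / 2.
  apply: (@le_trans _ _ (\sum_(q : 'I_p * bool) e1)); first exact: ler_sum.
  rewrite sumr_const -[leLHS]mulr_natr /e1 mulrAC ler_pdivrMr ?ltr0n//.
  by rewrite ler_wpM2l ?ler_nat//; lra.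
have e20 : 0 < e / 2 by lra.
have pullsM := (ge0_cvge0P _ _ (fun n => traj_prob_ge0 _ _ _ _ _ (L0 n))).1
  (pulls M) _ e20.
apply: filterS pullsM => n pn.
apply: (le_trans (traj_prob_le_deviation beta0 sigma (Lam n) (m n) _ M r
  sigma_gt0 (rule n) (ltW r0) _)).
  (* If no sample mean were off by [r], [tvM] would bound the distance by [eps]. *)
  move=> h /= tvh N_gt; apply: contrapT => no_dev.
  move: tvh; rewrite ltNge => /negP; apply; apply: tvM => // i.
  by rewrite ltNge; apply/negP => dev; apply: no_dev; exists i.
by rewrite [e in leRHS]splitr EFinD; apply: leeD; rewrite ?lee_fin.
Qed.
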